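(* Let $\alpha\in[0,1)$ and let $G$ be a connected graph of order $n\ge3$ and size $m\ge2$. Let $c=m\{\alpha^2n^3+n^2(2-4\alpha-\alpha^2)+n(4\alpha-2-2\alpha^2m)+4\alpha^2m\}$. If $s_n\ge\frac{\sqrt c}{2n}$, then $$E(A_\alpha(G))\ge\frac{2\sqrt2}{3}\sqrt{\left((1-\alpha)^2\,2m+\frac{\alpha^2}{2}(\Delta-\delta)^2\right)n},$$ where equality holds if and only if $G\cong K_3$.
   Context: Graphs are finite and simple; $\delta$ and $\Delta$ are the minimum and maximum vertex degrees of $G$. For a graph $G$ with $n$ vertices and $m$ edges, adjacency matrix $A(G)$ and diagonal degree matrix $D(G)$, $A_\alpha(G)=\alpha D(G)+(1-\alpha)A(G)$ with eigenvalues $p_1,\dots,p_n$. The numbers $s_1\ge s_2\ge\dots\ge s_n\ge0$ are the values $\left|p_i-\frac{2\alpha m}{n}\right|$, $i=1,\dots,n$, arranged in non-increasing order. The $A_\alpha$-energy is $E(A_\alpha(G))=\sum_{i=1}^n\left|p_i-\frac{2\alpha m}{n}\right|=\sum_{i=1}^n s_i$. *)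

(* Defs.v *)
From HB Require Import structures.
From mathcomp Require Import all_boot all_order all_algebra.
From mathcomp Require Import polyrcf.

Set Implicit Arguments.
Unset Strict Implicit.
Unset Printing Implicit Defensive.

Import Order.TTheory GRing.Theory Num.Theory.

Local Open Scope nat_scope.

Record sgraph := SGraph {
  vertex :> finType;
  adj : rel vertex;
  adj_sym : symmetric adj;
  adj_irr : irreflexive adj
}.

Section Graph.
Variable G : sgraph.

Definition edges : {set {set G}} :=
  [set [set p.1; p.2] | p in [pred p : G * G | adj p.1 p.2]].

Definition gsize : nat := #|edges|.

Definition degree (x : G) : nat := #|[set y | adj x y]|.

Definition max_degree : nat := \max_(x : G) degree x.

(* The default #|G| exceeds every degree, so this is the true minimum as soon
   as G has a vertex. *)
Definition min_degree : nat := \big[minn/#|G|]_(x : G) degree x.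

Definition connected_graph : Prop :=
  0 < #|G| /\ forall x y : G, connect (@adj G) x y.

End Graph.

Definition isomorphic (G H : sgraph) : Prop :=
  exists2 f : G -> H, bijective f & forall x y, adj (f x) (f y) = adj x y.

Lemma complete_sym n : symmetric (fun x y : 'I_n => x != y).
Proof. by move=> x y; rewrite eq_sym. Qed.

Lemma complete_irr n : irreflexive (fun x y : 'I_n => x != y).
Proof. by move=> x; rewrite eqxx. Qed.

Definition complete_graph (n : nat) : sgraph :=
  SGraph (@complete_sym n) (@complete_irr n).

Local Open Scope ring_scope.

(* The eigenvalues in R, each repeated according to its algebraic multiplicity;
   for a symmetric matrix of order n these are all the n eigenvalues. *)
Definition eigenvalues (R : rcfType) (n : nat) (M : 'M[R]_n) : seq R :=
  flatten [seq nseq (mup x (char_poly M)) x | x <- rootsR (char_poly M)].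

Section AlphaMatrix.
Variables (R : rcfType) (alpha : R) (G : sgraph).

Definition adj_matrix : 'M[R]_#|G| :=
  \matrix_(i, j) (adj (enum_val i) (enum_val j))%:R.

Definition degree_matrix : 'M[R]_#|G| :=
  diag_mx (\row_i (degree (enum_val i))%:R).

Definition A_alpha : 'M[R]_#|G| :=
  alpha *: degree_matrix + (1 - alpha) *: adj_matrix.

Definition A_alpha_deviations : seq R :=
  [seq `|p - 2 * alpha * (gsize G)%:R / #|G|%:R| | p <- eigenvalues A_alpha].

(* s_k of the text is entry k - 1 of this sequence. *)
Definition s_seq : seq R := sort >=%O A_alpha_deviations.

Definition A_alpha_energy : R :=
  \sum_(p <- eigenvalues A_alpha) `|p - 2 * alpha * (gsize G)%:R / #|G|%:R|.

End AlphaMatrix.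

(* Main.v *)
(* Let x_1, ..., x_n be the eigenvalues of A_alpha shifted by 2 alpha m / n, so
   that the s_i are the |x_i| and sum x_i = 0, and let S = sum x_i^2.
   Put h = sqrt c / (2n). De Caen's bound on the sum of squared degrees gives
   (n - 1) S <= 4 n h^2, and sum x_i = 0 gives n x_i^2 <= (n - 1) S, hence
   h <= s_i <= 2h for all i. Summing (s_i - h) (2h - s_i) >= 0 and using AM-GM,
   3 h E >= S + 2 n h^2 >= 2 sqrt (2 n h^2 S), while
   S >= 2 m (1 - alpha)^2 + (alpha^2 / 2) (Delta - delta)^2.
   Equality forces S = 2 n h^2, so n <= 3 by de Caen, and the path on three
   vertices is excluded: there equality forces alpha = 0, and then 0 is an
   eigenvalue, against s_n >= h > 0. *)
Require Import Defs.
From HB Require Import structures.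
From mathcomp Require Import all_boot all_order all_algebra.
From mathcomp Require Import polyrcf complex spectral sesquilinear.
From mathcomp Require Import ring lra.

Set Implicit Arguments.
Unset Strict Implicit.
Unset Printing Implicit Defensive.

Import Order.TTheory GRing.Theory Num.Theory.

Local Open Scope ring_scope.

Lemma char_poly_similar (R : comUnitRingType) (n : nat) (P A : 'M[R]_n) :
  P \in unitmx -> char_poly (invmx P *m A *m P) = char_poly A.
Proof.
move=> uP; rewrite /char_poly /char_poly_mx.
have PK : map_mx polyC (invmx P) *m map_mx polyC P = 1%:M.
  by rewrite -map_mxM mulVmx // map_mx1.
have -> : 'X%:M - map_mx polyC (invmx P *m A *m P) =
    map_mx polyC (invmx P) *m ('X%:M - map_mx polyC A) *m map_mx polyC P.
  rewrite mulmxBr mulmxBl !map_mxM scalar_mxC.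
  by rewrite -(mulmxA _ _ (map_mx _ P)) -[in RHS](mulmxA 'X%:M)
    PK mulmx1 mulmxA.
by rewrite !det_mulmx mulrAC -det_mulmx PK det1 mul1r.
Qed.

Lemma symmetric_spectral (R : rcfType) (n : nat) (M : 'M[R]_n) : M^T = M ->
  exists (P : 'M[R[i]]_n) (d : 'rV[R]_n), P \in unitmx /\
    map_mx (real_complex R) M =
      invmx P *m map_mx (real_complex R) (diag_mx d) *m P.
Proof.
move=> symM; set A := map_mx _ M.
have realA : A \is a mxOver Num.real.
  by apply/mxOverP => i j; rewrite mxE; apply/complex_realP; exists (M i j).
have symA : A^T = A by rewrite /A map_trmx symM.
have hermA : A \is hermsymmx.
  apply: realsym_hermsym realA; apply/is_hermitianmxP.
  by rewrite expr0 scale1r map_mx_id.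
have /orthomx_spectralP specA := hermitian_normalmx hermA.
exists (spectralmx A), (map_mx (@complex.Re R) (spectral_diag A)).
split; first exact: spectral_unit.
rewrite {1}specA map_diag_mx -map_mx_comp.
congr (_ *m diag_mx _ *m _); apply/rowP => i; rewrite !mxE /=.
by rewrite RRe_real //; apply/mxOverP/hermitian_spectral_diag_real.
Qed.

Lemma eigenvalues_split (R : rcfType) (n : nat) (M : 'M[R]_n) (s : seq R) :
  char_poly M = \prod_(x <- s) ('X - x%:P) -> perm_eq (eigenvalues M) s.
Proof.
move=> pM; have nz : char_poly M != 0 by rewrite monic_neq0 ?char_poly_monic.
apply/allP => x _ /=; apply/eqP; rewrite /eigenvalues count_flatten -map_comp.
rewrite -(mu_prod_XsubC x s) -pM.
have -> : [seq (count_mem x \o (fun y => nseq (mup y (char_poly M)) y)) y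
   | y <- rootsR (char_poly M)] =
  [seq if y == x then mup x (char_poly M) else 0%N | y <- rootsR (char_poly M)].
  apply: eq_map => y /=; rewrite count_nseq /=.
  by case: eqP => [->|_]; rewrite ?mul1n ?mul0n.
rewrite sumnE big_map -big_mkcond /=.
have [xr|xr] := boolP (x \in rootsR (char_poly M)).
  by rewrite -big_filter filter_pred1_uniq ?uniq_roots // big_seq1.
rewrite big1_seq => [|y /andP[/eqP-> yr]]; last by rewrite yr in xr.
by rewrite mupNroot // -[root _ x]andTb roots_on_rootsR.
Qed.

Lemma degreeE (G : sgraph) (x : G) : degree x = (\sum_(y : G) adj x y)%N.
Proof. by rewrite /degree cardsE -sum1_card big_mkcond. Qed.

Lemma degree_lt_order (G : sgraph) (x : G) : (degree x < #|G|)%N.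
Proof.
rewrite -[X in (_ < X)%N]cardsT /degree; apply: proper_card.
rewrite properT; apply: contraFneq (adj_irr x) => e.
by have := in_setT x; rewrite -e inE.
Qed.

Lemma handshake (G : sgraph) : (\sum_(x : G) degree x = (gsize G).*2)%N.
Proof.
under eq_bigr do rewrite degreeE.
rewrite pair_bigA /= -big_mkcond /=.
rewrite (partition_big_imset (fun p : G * G => [set p.1; p.2])) /=.
have -> : (gsize G).*2 = (\sum_(e in edges G) 2)%N.
  by rewrite sum_nat_const muln2.
apply: eq_big => [e|e /imsetP[[a b] /= ab ->]]; first by [].
have nab : a != b by apply: contraTneq ab => ->; rewrite unfold_in /= adj_irr.
have -> : 2%N = #|[set (a, b); (b, a)]|.
  by rewrite cards2 xpair_eqE (negPf nab).
rewrite -sum1_card; apply: eq_bigl => -[x y].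
rewrite !inE unfold_in /= !xpair_eqE.
apply/andP/orP => [[xy /eqP exy]|].
  have nxy : x != y by apply: contraTneq xy => ->; rewrite adj_irr.
  have := set21 x y; have := set22 x y; rewrite exy !inE.
  move=> /orP[]/eqP ey /orP[]/eqP ex; move: nxy; rewrite ex ey ?eqxx //.
    by right.
  by left.
case=> /andP[/eqP-> /eqP->]; split=> //; last by rewrite setUC.
by rewrite adj_sym.
Qed.

Lemma min_degree_le (G : sgraph) (x : G) : (min_degree G <= degree x)%N.
Proof.
rewrite /min_degree; elim: index_enum (mem_index_enum x) => // y s IH.
rewrite inE big_cons geq_min => /orP[/eqP<-|/IH->]; last exact: orbT.
by rewrite leqnn.
Qed.

Lemma min_degree_attained (G : sgraph) : (0 < #|G|)%N ->
  exists x : G, degree x = min_degree G.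
Proof.
case/card_gt0P => x0 _; case: (@arg_minnP G x0 xpredT (@degree G) isT) => x _ h.
exists x; apply/eqP; rewrite eqn_leq min_degree_le andbT /min_degree.
elim/big_ind: _ => [|a b|y _]; rewrite ?leq_min.
- exact/ltnW/degree_lt_order.
- by move=> -> ->.
- exact: h.
Qed.

Lemma max_degree_attained (G : sgraph) : (0 < #|G|)%N ->
  exists x : G, degree x = max_degree G.
Proof. by move=> /(bigop.eq_bigmax (@degree G))[x e]; exists x. Qed.

Lemma connected_degree_gt0 (G : sgraph) (x : G) :
  connected_graph G -> (1 < #|G|)%N -> (0 < degree x)%N.
Proof.
move=> [_ con] n2; rewrite card_gt0.
have /card_gt0P[y] : (0 < #|[set~ x]|)%N.
  by rewrite cardsC1 -ltnS prednK // ltnW.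
rewrite !inE => nyx; have /connectP[[|z p] /= xp ey] := con x y.
  by rewrite ey eqxx in nyx.
by apply/set0Pn; exists z; rewrite inE; case/andP: xp.
Qed.

Section DegreeSums.
Variables (R : rcfType) (G : sgraph).
Local Notation n := (#|G|%:R : R).
Local Notation m := ((gsize G)%:R : R).
Local Notation d x := ((degree x)%:R : R).
Local Notation a x y := ((adj x y)%:R : R).

Lemma natr_degree (x : G) : d x = \sum_y a x y.
Proof. by rewrite degreeE natr_sum. Qed.

Lemma sum_degree : \sum_(x : G) d x = 2 * m.
Proof. by rewrite -natr_sum handshake -mul2n natrM. Qed.

Lemma sum_const (c : R) : \sum_(x : G) c = n * c.
Proof. by rewrite sumr_const mulr_natl. Qed.

Lemma natr_degree_le (x : G) : d x <= n - 1.
Proof.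
by rewrite lerBrDr -[X in _ + X]/(1%:R) -natrD ler_nat addn1 degree_lt_order.
Qed.

Lemma neighbor_degree_sum_le (x : G) :
  \sum_y a x y * d y <= d x * (n - 1).
Proof.
rewrite natr_degree mulr_suml; apply: ler_sum => y _.
by rewrite ler_wpM2l ?ler0n ?natr_degree_le.
Qed.

Lemma neighbor_degree_sum_le_size (x : G) : (forall y : G, 0 < degree y)%N ->
  \sum_y a x y * d y + (n - 1) <= 2 * m.
Proof.
move=> dpos; have d1 (y : G) : 1 <= d y by rewrite ler1n dpos.
rewrite -sum_degree -lerBrDl -sumrB.
have -> : n - 1 = \sum_(y : G) (1 - a x y + (x == y)%:R * (d x - 1)).
  rewrite big_split sumrB -natr_degree sum_const mulr1 -mulr_suml /=.
  rewrite (bigD1 x) //= eqxx big1 =>[|y /negPf]; first by rewrite mulr1n; ring.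
  by rewrite eq_sym => ->.
apply: ler_sum => y _; have := d1 y; have [<-|_] := eqVneq x y.
  by rewrite adj_irr /= => _; lra.
by case: adj => /=; lra.
Qed.

(* With [t x] the sum of the degrees of the neighbours of [x], add [d x] times
   [t x + (n - 1) <= 2 * m] to [n - 1 - d x] times [t x <= d x * (n - 1)], then
   sum over [x], using that the [t x] sum up to the sum of the [d x ^+ 2]. *)
Lemma de_caen : (forall y : G, 0 < degree y)%N ->
  (n - 1) * \sum_(x : G) d x ^+ 2 <= m * (2 * m + (n - 1) * (n - 2)).
Proof.
move=> dpos; pose t (x : G) := \sum_y a x y * d y.
have sumt : \sum_x t x = \sum_(x : G) d x ^+ 2.
  rewrite exchange_big; apply: eq_bigr => y _ /=.
  rewrite -mulr_suml expr2 natr_degree; congr (_ * _).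
  by apply: eq_bigr => x _; rewrite adj_sym.
have H (x : G) : (n - 1) * t x + (n - 1) * d x ^+ 2 <=
    (2 * m + (n - 1) * (n - 2)) * d x.
  have h1 := neighbor_degree_sum_le x.
  have h2 := neighbor_degree_sum_le_size x dpos.
  have h3 := natr_degree_le x; have h4 : 0 <= d x by [].
  rewrite -/(t x) in h1 h2; nra.
have : \sum_x ((n - 1) * t x + (n - 1) * d x ^+ 2) <=
    \sum_(x : G) (2 * m + (n - 1) * (n - 2)) * d x by apply: ler_sum => x _.
rewrite big_split -!mulr_sumr sumt sum_degree /=; lra.
Qed.

Lemma degree_variance_ge : (0 < #|G|)%N ->
  4 * m ^+ 2 / n + ((max_degree G)%:R - (min_degree G)%:R) ^+ 2 / 2
    <= \sum_(x : G) d x ^+ 2.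
Proof.
move=> npos; have [x <-] := max_degree_attained npos.
have [y <-] := min_degree_attained npos.
have n0 : 0 < n by rewrite ltr0n.
pose u := 2 * m / n.
have -> : 4 * m ^+ 2 / n = n * u ^+ 2 by rewrite /u; field; rewrite gt_eqF.
have un : 2 * m = n * u by rewrite /u mulrCA divff ?mulr1 ?gt_eqF.
suff : (d x - d y) ^+ 2 / 2 <= \sum_(z : G) (d z - u) ^+ 2.
  have -> : \sum_(z : G) (d z - u) ^+ 2 = 
     \sum_(z : G) d z ^+ 2 - 2 * u * \sum_(z : G) d z + \sum_(z : G) u ^+ 2.
    by rewrite mulr_sumr -sumrB -big_split; apply: eq_bigr => z _ /=; ring.
  rewrite sum_degree sum_const un; lra.
have [<-|nxy] := eqVneq x y.
  by rewrite subrr expr0n mul0r sumr_ge0 // => z _; rewrite sqr_ge0.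
rewrite (bigD1 x) //= (bigD1 y) /=; last by rewrite eq_sym.
have : 0 <= \sum_(i | (i != x) && (i != y)) (d i - u) ^+ 2.
  by rewrite sumr_ge0 // => z _; rewrite sqr_ge0.
have := sqr_ge0 (d x + d y - 2 * u); nra.
Qed.
End DegreeSums.

Lemma symmetric_eigenvalues (R : rcfType) (n : nat) (M : 'M[R]_n) :
  M^T = M ->
  [/\ size (eigenvalues M) = n,
      \sum_(x <- eigenvalues M) x = \tr M &
      \sum_(x <- eigenvalues M) x ^+ 2 = \tr (M *m M)].
Proof.
move=> /symmetric_spectral[P [d [uP MP]]].
have CI : injective (real_complex R) by exact: complexI.
have pM : char_poly M = \prod_(x <- [seq d 0 i | i : 'I_n]) ('X - x%:P).
  rewrite big_image /=.
  have := @char_poly_trig _ _ (diag_mx d) (diag_mx_is_trig d).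
  have -> : \prod_i ('X - (diag_mx d i i)%:P) = \prod_i ('X - (d 0 i)%:P).
    by apply: eq_bigr => i _; rewrite mxE eqxx mulr1n.
  move=> <-; apply: (map_poly_inj (real_complex R)).
  by rewrite !map_char_poly /= MP char_poly_similar.
have e := eigenvalues_split pM.
split.
- by rewrite (perm_size e) size_image card_ord.
- rewrite (perm_big _ e) big_image /= -mxtrace_diag; apply: CI.
  by rewrite -!trace_map_mx MP mxtrace_mulC mulmxA mulmxV // mul1mx.
- rewrite (perm_big _ e) big_image /=.
  have -> : \sum_i d 0 i ^+ 2 = \tr (diag_mx d *m diag_mx d).
    rewrite mulmx_diag mxtrace_diag.
    by apply: eq_bigr => i _; rewrite !mxE -expr2.
  apply: CI; rewrite -!trace_map_mx.
  have -> : map_mx (real_complex R) (M *m M) =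
      invmx P *m map_mx (real_complex R) (diag_mx d *m diag_mx d) *m P.
    by rewrite !map_mxM MP !mulmxA mulmxK.
  by rewrite mxtrace_mulC mulmxA mulmxV // mul1mx.
Qed.

Section AlphaTraces.
Variables (R : rcfType) (alpha : R) (G : sgraph).
Local Notation n := (#|G|%:R : R).
Local Notation m := ((gsize G)%:R : R).
Local Notation mean := (2 * alpha * m / n).
Local Notation Aalpha := (A_alpha alpha G).

Lemma A_alphaE i j : Aalpha i j =
  alpha * ((degree (enum_val i))%:R *+ (i == j)) +
  (1 - alpha) * (adj (enum_val i) (enum_val j))%:R.
Proof. by rewrite !mxE. Qed.

Lemma A_alpha_sym : Aalpha^T = Aalpha.
Proof.
apply/matrixP => i j; rewrite mxE !A_alphaE adj_sym eq_sym.
by case: eqVneq => [->|]; rewrite ?mulr0n.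
Qed.

Lemma sum_enum_val (F : G -> R) :
  \sum_(i < #|G|) F (enum_val i) = \sum_x F x.
Proof. by rewrite [RHS](reindex _ (onW_bij _ (@enum_val_bij G))). Qed.

Lemma trace_A_alpha : \tr Aalpha = 2 * alpha * m.
Proof.
rewrite -mulrA mulrCA -(sum_degree R G) -sum_enum_val mulr_sumr.
by apply: eq_bigr => i _; rewrite A_alphaE eqxx adj_irr mulr0 addr0.
Qed.

Lemma trace_A_alpha_sqr : \tr (Aalpha *m Aalpha) =
  alpha ^+ 2 * (\sum_(x : G) (degree x)%:R ^+ 2) + (1 - alpha) ^+ 2 * (2 * m).
Proof.
rewrite -(sum_degree R G) -!sum_enum_val !mulr_sumr -big_split.
apply: eq_bigr => i _; rewrite mxE /=.
transitivity (\sum_j (alpha ^+ 2 * ((degree (enum_val i))%:R ^+ 2 *+ (i == j)) +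
   (1 - alpha) ^+ 2 * (adj (enum_val i) (enum_val j))%:R) : R).
  apply: eq_bigr => j _; rewrite !A_alphaE adj_sym eq_sym.
  have [->|_] := eqVneq; first by rewrite adj_irr !mulr1n mulr0n; ring.
  by case: adj; rewrite ?mulr0n ?mulr1n; ring.
rewrite big_split -!mulr_sumr /= (bigD1 i) //= eqxx big1 ?addr0 //.
  by rewrite (sum_enum_val (fun y => (adj (enum_val i) y)%:R)) -natr_degree.
by move=> j /negPf; rewrite eq_sym => ->.
Qed.

Definition centered : seq R := [seq p - mean | p <- eigenvalues Aalpha].

Lemma size_centered : size centered = #|G|.
Proof. by rewrite size_map; have [] := symmetric_eigenvalues A_alpha_sym. Qed.

Lemma sum_centered : (0 < #|G|)%N -> \sum_(x <- centered) x = 0.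
Proof.
move=> n0; have nz : n != 0 by rewrite pnatr_eq0 -lt0n.
have [sz tr _] := symmetric_eigenvalues A_alpha_sym.
rewrite big_map sumrB tr trace_A_alpha big_const_seq count_predT sz iter_addr_0.
by rewrite -mulr_natl; field.
Qed.

Lemma sum_centered_sqr : (0 < #|G|)%N -> \sum_(x <- centered) x ^+ 2 =
  (1 - alpha) ^+ 2 * (2 * m) +
  alpha ^+ 2 * (\sum_(x : G) (degree x)%:R ^+ 2 - 4 * m ^+ 2 / n).
Proof.
move=> n0; have nz : n != 0 by rewrite pnatr_eq0 -lt0n.
have [sz tr tr2] := symmetric_eigenvalues A_alpha_sym.
have -> : \sum_(x <- centered) x ^+ 2 =
   \sum_(p <- eigenvalues Aalpha) p ^+ 2
   - 2 * mean * \sum_(p <- eigenvalues Aalpha) p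
   + \sum_(p <- eigenvalues Aalpha) mean ^+ 2.
  rewrite mulr_sumr -sumrB -big_split big_map.
  by apply: eq_bigr => p _ /=; ring.
rewrite tr tr2 trace_A_alpha trace_A_alpha_sqr.
rewrite big_const_seq count_predT sz iter_addr_0 -mulr_natl.
by field.
Qed.
End AlphaTraces.

Lemma ler_sum_seq (R : numDomainType) (s : seq R) (F1 F2 : R -> R) :
  {in s, forall x, F1 x <= F2 x} ->
  \sum_(x <- s) F1 x <= \sum_(x <- s) F2 x.
Proof. by move=> le12; rewrite !big_seq; apply: ler_sum. Qed.

(* Cauchy-Schwarz for the other terms, which sum to [- x]. *)
Lemma sum_zero_sqr_le (R : realFieldType) (s : seq R) (x : R) :
  x \in s -> \sum_(y <- s) y = 0 ->
  (size s)%:R * x ^+ 2 <= ((size s)%:R - 1) * \sum_(y <- s) y ^+ 2.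
Proof.
move=> xs; have px := perm_to_rem xs.
rewrite (perm_size px) !(perm_big _ px) !big_cons /= => s0.
set t := rem x s in s0 *; set k : R := (size t)%:R.
rewrite -natr1 -/k addrK.
have : 0 <= \sum_(y <- t) (k * y + x) ^+ 2.
  by rewrite sumr_ge0 // => y _; rewrite sqr_ge0.
have -> : \sum_(y <- t) (k * y + x) ^+ 2 =
    k ^+ 2 * \sum_(y <- t) y ^+ 2 + 2 * k * x * \sum_(y <- t) y
    + \sum_(y <- t) x ^+ 2.
  by rewrite !mulr_sumr -!big_split; apply: eq_bigr => y _ /=; ring.
rewrite big_const_seq count_predT iter_addr_0 -mulr_natl -/k.
have -> : \sum_(y <- t) y = - x by apply/eqP; rewrite -addr_eq0 addrC s0.
have [k0|k0 h] := eqVneq k 0.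
  suff -> : x = 0 by rewrite k0 mul0r expr2 !mulr0.
  have t0 : size t = 0%N by apply/eqP; rewrite -(pnatr_eq0 R) -/k k0.
  by move: s0; rewrite (size0nil t0) big_nil addr0.
have kp : 0 < k by rewrite lt_def k0 ler0n.
suff : 0 <= k * (k * \sum_(y <- t) y ^+ 2 - x ^+ 2).
  by rewrite pmulr_rge0 //; lra.
lra.
Qed.

Lemma sum_norm_ge (R : realFieldType) (s : seq R) (h : R) :
  {in s, forall x, h <= `|x| <= 2 * h} ->
  \sum_(x <- s) x ^+ 2 + 2 * (size s)%:R * h ^+ 2
    <= 3 * h * \sum_(x <- s) `|x|.
Proof.
move=> hs.
have -> : 2 * (size s)%:R * h ^+ 2 = \sum_(x <- s) (2 * h ^+ 2).
  by rewrite big_const_seq count_predT iter_addr_0 -mulr_natl; ring.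
rewrite mulr_sumr -big_split; apply: ler_sum_seq => x /hs /andP[h1 h2] /=.
by rewrite -real_normK ?num_real //; nra.
Qed.

Lemma sqr_ge_of_amgm (R : realFieldType) (n h B S E : R) :
  0 < n -> 0 < h -> 0 <= S -> B <= S -> S + 2 * n * h ^+ 2 <= 3 * h * E ->
  8 * B * n <= 9 * E ^+ 2 /\
  (9 * E ^+ 2 = 8 * B * n -> S = 2 * n * h ^+ 2 /\ B = S).
Proof.
move=> n0 h0 S0 BS SE.
have h2 : 0 < h ^+ 2 by rewrite exprn_gt0.
have nh : 0 < n * h ^+ 2 by rewrite mulr_gt0.
have sqE : (S + 2 * n * h ^+ 2) ^+ 2 <= (3 * h * E) ^+ 2.
  by rewrite lerXn2r ?nnegrE //; lra.
have key : (S - 2 * n * h ^+ 2) ^+ 2 + 8 * n * h ^+ 2 * (S - B)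
     <= h ^+ 2 * (9 * E ^+ 2 - 8 * B * n) by lra.
have p1 : 0 <= (S - 2 * n * h ^+ 2) ^+ 2 by rewrite sqr_ge0.
have p2 : 0 <= 8 * n * h ^+ 2 * (S - B).
  by rewrite mulr_ge0 ?subr_ge0 //; lra.
split.
  have : 0 <= h ^+ 2 * (9 * E ^+ 2 - 8 * B * n) by lra.
  by rewrite pmulr_rge0 // subr_ge0.
move=> e; rewrite e subrr mulr0 in key.
have /eqP : (S - 2 * n * h ^+ 2) ^+ 2 = 0 by lra.
rewrite sqrf_eq0 subr_eq0 => /eqP eS; split=> //.
have /eqP : 8 * n * h ^+ 2 * (S - B) = 0 by lra.
rewrite mulf_eq0 subr_eq0 => /orP[/eqP|/eqP//]; lra.
Qed.

(* Two of the three numbers share a sign, so the third has modulus at least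
   [2 * h], hence exactly [2 * h]. *)
Lemma sum_norm_three (R : realFieldType) (s : seq R) (h : R) :
  size s = 3%N -> \sum_(x <- s) x = 0 ->
  {in s, forall x, h <= `|x| <= 2 * h} -> \sum_(x <- s) `|x| = 4 * h.
Proof.
case: s => [|x [|y [|z []]]] //= _; rewrite !big_cons !big_nil => s0 hs.
have /andP[] := hs x (mem_head _ _).
have /andP[] : h <= `|y| <= 2 * h by apply: hs; rewrite !inE eqxx orbT.
have /andP[] : h <= `|z| <= 2 * h by apply: hs; rewrite !inE eqxx !orbT.
by case: (ger0P x); case: (ger0P y); case: (ger0P z); lra.
Qed.

Lemma mem_eigenvalues (R : rcfType) (n : nat) (M : 'M[R]_n) (x : R) :
  root (char_poly M) x -> x \in eigenvalues M.
Proof.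
have nz : char_poly M != 0 by rewrite monic_neq0 ?char_poly_monic.
move=> rx; apply/flattenP; exists (nseq (mup x (char_poly M)) x).
  by apply/mapP; exists x; rewrite // -roots_on_rootsR ?inE.
by rewrite mem_nseq eqxx andbT -XsubC_dvd // dvdp_XsubCl.
Qed.

Lemma twins_eigenvalue0 (R : rcfType) (G : sgraph) (x y : G) :
  x != y -> (forall z, adj x z = adj y z) ->
  (0 : R) \in eigenvalues (A_alpha 0 G).
Proof.
move=> nxy twins; apply: mem_eigenvalues.
rewrite rootE horner_coef0 char_poly_det.
rewrite (@determinant_alternate _ _ _ (enum_rank x) (enum_rank y)) ?mulr0 //.
  by apply: contra nxy => /eqP/enum_rank_inj ->.
by move=> j; rewrite !A_alphaE !enum_rankK !mul0r twins.
Qed.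

Lemma sorted_last_le (R : realDomainType) (s : seq R) (x : R) :
  x \in s -> (sort >=%O s)`_(size s).-1 <= x.
Proof.
move=> xs; have xt : x \in sort >=%O s by rewrite mem_sort.
rewrite -[X in _ <= X](nth_index 0 xt).
have srt : sorted >=%O (sort >=%O s).
  by apply: sort_sorted => a b; exact: le_total.
have s0 : (0 < size s)%N by case: (s) xs.
have le_idx : (index x (sort >=%O s) < size s)%N.
  by rewrite -(size_sort >=%O) index_mem.
apply: (@sorted_leq_nth _ >=%O _ _ 0 _ srt) => //.
- by move=> a b c /= ab bc; apply: le_trans bc ab.
- exact: lexx.
- by rewrite inE size_sort.
- by rewrite inE size_sort ltn_predL.
- by rewrite -ltnS prednK.
Qed.

Lemma isomorphic_completeP (G : sgraph) (k : nat) :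
  isomorphic G (complete_graph k) <->
  #|G| = k /\ forall x y : G, adj x y = (x != y).
Proof.
split=> [[f bf fadj]|[cG Gadj]].
  split; first by rewrite (bij_eq_card bf) card_ord.
  by move=> x y; rewrite -fadj /= (inj_eq (bij_inj bf)).
exists (fun x => cast_ord cG (enum_rank x) : complete_graph k).
  exists (fun i : 'I_k => enum_val (cast_ord (esym cG) i)) => [x|i].
    by rewrite /= cast_ordK enum_rankK.
  by rewrite /= enum_valK cast_ordKV.
move=> x y.
by rewrite /= Gadj (inj_eq (@cast_ord_inj _ _ _)) (inj_eq enum_rank_inj).
Qed.

Lemma complete_degree (G : sgraph) (x : G) :
  (forall x y : G, adj x y = (x != y)) -> degree x = #|G|.-1.
Proof.
move=> Gadj; rewrite /degree -(cardsC1 x); apply: eq_card => y.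
by rewrite !inE Gadj eq_sym.
Qed.

Lemma order3_cases (G : sgraph) : #|G| = 3%N -> (2 <= gsize G)%N ->
  (forall x y : G, adj x y = (x != y)) \/
  [/\ gsize G = 2%N, max_degree G = 2%N, min_degree G = 1%N,
      (\sum_(x : G) degree x ^ 2 = 6)%N &
      exists x y : G, x != y /\ forall z, adj x z = adj y z].
Proof.
move=> G3; rewrite -leq_double -handshake -(doubleK (gsize G)) -handshake.
rewrite /max_degree /min_degree G3.
have degE (x : G) := degreeE x.
have all_mem := @mem_index_enum G.
have : size (index_enum G) = 3%N by rewrite -sum1_size sum1_card.
have := index_enum_uniq G.
case: (index_enum G) degE all_mem => [|a [|b [|c []]]] //= degE all_mem.
rewrite !inE negb_or -!andbA => /and4P[nab nac nbc _] _.
have in3 x : [\/ x = a, x = b | x = c].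
  by have := all_mem x; rewrite !inE => /or3P[]/eqP->; constructor.
rewrite !(big_cons, big_nil) !degE !(big_cons, big_nil) !adj_irr.
have ba := adj_sym b a; have ca := adj_sym c a; have cb := adj_sym c b.
rewrite ba ca cb.
case ab: (adj a b) ba; case ac: (adj a c) ca;
  case bc: (adj b c) cb => //= cb ca ba _.
- left=> x y; have nE := (negPf nab, negPf nac, negPf nbc).
  by case: (in3 x) => ->; case: (in3 y) => ->;
    rewrite ?(adj_irr, ab, ac, bc, ba, ca, cb, eqxx, nE) // eq_sym nE.
- right; split=> //; exists b, c; split=> // z.
  by case: (in3 z) => ->; rewrite ?(adj_irr, ab, ac, bc, ba, ca, cb).
- right; split=> //; exists a, c; split=> // z.
  by case: (in3 z) => ->; rewrite ?(adj_irr, ab, ac, bc, ba, ca, cb).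
- right; split=> //; exists a, b; split=> // z.
  by case: (in3 z) => ->; rewrite ?(adj_irr, ab, ac, bc, ba, ca, cb).
Qed.

Lemma A_alpha_deviationsE (R : rcfType) (alpha : R) (G : sgraph) :
  A_alpha_deviations alpha G = [seq `|x| | x <- centered alpha G].
Proof. by rewrite -map_comp. Qed.

Lemma A_alpha_energyE (R : rcfType) (alpha : R) (G : sgraph) :
  A_alpha_energy alpha G = \sum_(x <- centered alpha G) `|x|.
Proof. by rewrite big_map. Qed.

Lemma s_last_le (R : rcfType) (alpha : R) (G : sgraph) :
  {in centered alpha G, forall x, (s_seq alpha G)`_(#|G|.-1) <= `|x|}.
Proof.
move=> x xs; rewrite -(size_centered alpha G) /s_seq A_alpha_deviationsE.
by rewrite -(size_map Num.norm); apply/sorted_last_le/map_f.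
Qed.

Theorem corollary4p3 (R : rcfType) (alpha : R) (G : sgraph)
    (halpha : 0 <= alpha < 1) (hconn : connected_graph G)
    (hn : (3 <= #|G|)%N) (hm : (2 <= gsize G)%N) :
  let n : R := #|G|%:R in
  let m : R := (gsize G)%:R in
  let Delta : R := (max_degree G)%:R in
  let delta : R := (min_degree G)%:R in
  let c : R := m * (alpha ^+ 2 * n ^+ 3
                    + n ^+ 2 * (2 - 4 * alpha - alpha ^+ 2)
                    + n * (4 * alpha - 2 - 2 * alpha ^+ 2 * m)
                    + 4 * alpha ^+ 2 * m) in
  let s_n : R := (s_seq alpha G)`_(#|G|.-1) in
  let bound : R :=
    2 * Num.sqrt 2 / 3
    * Num.sqrt (((1 - alpha) ^+ 2 * (2 * m)
                 + alpha ^+ 2 / 2 * (Delta - delta) ^+ 2) * n) in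
  Num.sqrt c / (2 * n) <= s_n ->
  bound <= A_alpha_energy alpha G /\
  (A_alpha_energy alpha G = bound <-> isomorphic G (complete_graph 3)).
Proof.
move=> n m Delta delta c s_n bound hs.
have npos : (0 < #|G|)%N by apply: leq_trans hn.
have n3 : 3 <= n by rewrite (ler_nat _ 3).
have m2 : 2 <= m by rewrite (ler_nat _ 2).
have deg0 (x : G) : (0 < degree x)%N by apply: connected_degree_gt0 (ltnW hn).
pose Q : R := \sum_(x : G) (degree x)%:R ^+ 2.
pose X := centered alpha G.
pose S : R := \sum_(x <- X) x ^+ 2.
pose h : R := Num.sqrt c / (2 * n).
pose B : R :=
  (1 - alpha) ^+ 2 * (2 * m) + alpha ^+ 2 / 2 * (Delta - delta) ^+ 2.
pose E : R := \sum_(x <- X) `|x|.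
have n0 : 0 < n by lra.
have a1 : 0 < (1 - alpha) ^+ 2.
  by rewrite exprn_gt0 // subr_gt0; case/andP: halpha.
have SE : S = (1 - alpha) ^+ 2 * (2 * m) + alpha ^+ 2 * (Q - 4 * m ^+ 2 / n).
  exact: sum_centered_sqr.
have Xsum : \sum_(x <- X) x = 0 by exact: sum_centered.
have Xsize : (size X)%:R = n by rewrite size_centered.
have BS : B <= S.
  rewrite SE lerD2l -mulrA ler_wpM2l ?sqr_ge0 //.
  have := degree_variance_ge R npos.
  by rewrite -/n -/m -/Delta -/delta -/Q; lra.
have B0 : 0 < B.
  have : 0 <= alpha ^+ 2 / 2 * (Delta - delta) ^+ 2.
    by rewrite mulr_ge0 ?divr_ge0 ?sqr_ge0.
  have : 0 < (1 - alpha) ^+ 2 * (2 * m) by rewrite !mulr_gt0 //; lra.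
  by rewrite /B; lra.
have cS : n * (n - 1) * S <= c.
  have deC := de_caen R deg0; rewrite -/n -/m -/Q in deC.
  have : 0 <= n * alpha ^+ 2 * (m * (2 * m + (n - 1) * (n - 2)) - (n - 1) * Q).
    by rewrite mulr_ge0 ?subr_ge0 // mulr_ge0 ?sqr_ge0 // ltW.
  suff -> : n * (n - 1) * S = c - n * alpha ^+ 2 *
    (m * (2 * m + (n - 1) * (n - 2)) - (n - 1) * Q) by lra.
  by rewrite SE /c; field; rewrite gt_eqF.
have c0 : 0 < c.
  by apply: lt_le_trans cS; rewrite !mulr_gt0 //; lra.
have h0 : 0 < h by rewrite divr_gt0 ?sqrtr_gt0 // mulr_gt0.
have h2 : 4 * n ^+ 2 * h ^+ 2 = c.
  rewrite /h expr_div_n sqr_sqrtr ?ltW //; field; lra.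
have Sh : (n - 1) * S <= 4 * n * h ^+ 2.
  rewrite -(ler_pM2l n0); lra.
have Xh : {in X, forall x, h <= `|x| <= 2 * h}.
  move=> x xX; rewrite (le_trans hs) ?s_last_le //=.
  rewrite -(ler_pXn2r (ltn0Sn 1)) ?nnegrE //; last lra.
  rewrite real_normK ?num_real // -(ler_pM2l n0).
  have := sum_zero_sqr_le xX Xsum; rewrite Xsize -/S; lra.
have SE3 : S + 2 * n * h ^+ 2 <= 3 * h * E.
  by rewrite -Xsize; exact: sum_norm_ge.
have E0 : 0 <= E by rewrite sumr_ge0.
have [ineq eqc] := sqr_ge_of_amgm n0 h0 (ltW (lt_le_trans B0 BS)) BS SE3.
have b0 : 0 <= bound by rewrite !mulr_ge0 ?sqrtr_ge0 ?invr_ge0.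
have b2 : 9 * bound ^+ 2 = 8 * B * n.
  rewrite /bound -/B !exprMn exprVn !sqr_sqrtr ?mulr_ge0 ?ltW //; lra.
rewrite A_alpha_energyE -/X -/E; split.
  by rewrite -(ler_pXn2r (ltn0Sn 1)) ?nnegrE //; lra.
split=> [Eb|/isomorphic_completeP[G3 Gadj]].
  have [Sn BSeq] : S = 2 * n * h ^+ 2 /\ B = S by apply: eqc; rewrite Eb.
  have n3' : n <= 3.
    have nh : 0 < n * h ^+ 2 by apply/mulr_gt0/exprn_gt0.
    by rewrite -(ler_pM2l nh); rewrite Sn in Sh; lra.
  have G3 : #|G| = 3%N by apply/eqP; rewrite eqn_leq hn -(ler_nat R) n3'.
  have [Gadj|[m2' D2 d1 Q6 [x [y [nxy twins]]]]] := order3_cases G3 hm.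
    by apply/isomorphic_completeP.
  have alpha0 : alpha = 0.
    have Q6' : Q = 6.
      rewrite -[RHS]/(6%:R) -Q6 natr_sum.
      by apply: eq_bigr => z _; rewrite natrX.
    move: BSeq; rewrite SE /B /n /m /Delta /delta G3 m2' D2 d1 Q6' => BSeq.
    have /eqP : alpha ^+ 2 = 0 by lra.
    by rewrite sqrf_eq0 => /eqP.
  have : (0 : R) \in X.
    apply/mapP; exists 0; last by rewrite alpha0 mulr0 !mul0r subr0.
    by rewrite alpha0; exact: twins_eigenvalue0 nxy twins.
  by move/Xh; rewrite normr0; lra.
have degG (x : G) : degree x = 2%N by rewrite (complete_degree _ Gadj) G3.
have m3 : m = 3.
  have := sum_degree R G.
  rewrite (eq_bigr (fun=> 2)) => [|x _]; last by rewrite degG.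
  by rewrite sum_const -/m G3; lra.
have Dd : Delta = delta.
  rewrite /Delta /delta; have [x <-] := max_degree_attained npos.
  by have [y <-] := min_degree_attained npos; rewrite !degG.
have eE : E = 4 * h by apply: sum_norm_three; rewrite ?size_centered.
have nE : n = 3 by rewrite /n G3.
suff e2 : 9 * E ^+ 2 = 9 * bound ^+ 2.
  by apply/eqP; rewrite -(eqrXn2 (ltn0Sn 1)) //; apply/eqP; lra.
by rewrite b2 eE /B Dd nE m3; rewrite /c nE m3 in h2; lra.
Qed.
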